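(* Let $\boldsymbol m$ be a multicore of $\mathcal H_{r,n}$ (an $r$-multipartition of $n$ that is a multicore), and let $C$ be the core block of $\boldsymbol m$. Then there exist a multicore $\boldsymbol\mu$ in $C$ and a sequence of multicores $$\boldsymbol m=\boldsymbol m_0,\boldsymbol m_1,\dots,\boldsymbol m_{s-1},\boldsymbol m_s=\boldsymbol\mu$$ such that: 1) the core block of $\boldsymbol m_t$ is $C$ for all $t=0,\dots,s$; 2) for all $t=0,\dots,s-1$, $\boldsymbol m_{t+1}=s_{il}^{jk}(\boldsymbol m_t)$ for some $j,k\in\{1,\dots,r\}$ and $i,l\in\{0,1,\dots,e-1\}$; 3) there exists $0\le v\le s$ such that i) $w(\boldsymbol m_{t+1})<w(\boldsymbol m_t)$ for all $t=0,\dots,v-1$ and $w(\boldsymbol m_{t+1})\le w(\boldsymbol m_t)$ for all $t=v,\dots,s-1$; ii) $|\gamma_{il}^{jk}(\boldsymbol m_v)|\le2$ for all $i,l\in I$ and all $j,k\in\{1,\dots,r\}$.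
   Context: Setting. Let $r\ge1$, $\mathbb F$ a field, $2\le e<\infty$, $q\in\mathbb F$ a primitive $e$-th root of unity, $\kappa=(\kappa_1,\dots,\kappa_r)\in\mathbb Z^r$, $I=\{0,\dots,e-1\}$ identified with $\mathbb Z/e\mathbb Z$. $\mathcal H_{r,n}$ is the Ariki-Koike algebra over $\mathbb F$ (deformation of $\mathbb F[C_r\wr\mathfrak S_n]$) with parameters $q$ and $Q_j=q^{\kappa_j}$. A multicharge is any $\mathrm a\in\mathbb Z^r$ with $a_j\equiv\kappa_j \pmod e$ for all $j$. Multipartitions and blocks. An $r$-multipartition of $n$ is an $r$-tuple $\boldsymbol\lambda=(\lambda^{(1)},\dots,\lambda^{(r)})$ of partitions of total size $n$, with nodes $(b,c,j)$, $c\le\lambda^{(j)}_b$; the node $(b,c,j)$ has residue $\kappa_j+c-b \bmod e$. $\boldsymbol\lambda$ lies in the block of $\mathcal H_{r,n}$ containing its Specht module; two $r$-multipartitions of $n$ lie in the same block iff their multisets of residues coincide. Hub, weight. $\delta_i^j(\boldsymbol\lambda)$ is the number of removable minus the number of addable nodes of residue $i$ in component $j$; $\delta_i(\boldsymbol\lambda)=\sum_j\delta_i^j(\boldsymbol\lambda)$; the hub is $(\delta_i(\boldsymbol\lambda))_{i\in I}$. With $c_i(\boldsymbol\lambda)$ the number of nodes of residue $i$, the weight is $w(\boldsymbol\lambda)=\sum_{j=1}^r c_{\kappa_j}(\boldsymbol\lambda)-\frac12\sum_{i\in I}(c_i(\boldsymbol\lambda)-c_{i+1}(\boldsymbol\lambda))^2$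 (subscripts mod $e$). Both depend only on the block. Abacus. For a multicharge $\mathrm a$, the $\beta$-numbers of $\lambda^{(j)}$ are $\lambda^{(j)}_m+a_j-m$ ($m\ge1$). The $e$-abacus of $\lambda^{(j)}$ has runners $0,\dots,e-1$, with a bead at position $xe+l$ (runner $l$, level $x$) for each $\beta$-number $xe+l$. A multicore is a multipartition all of whose components are $e$-cores (all beads pushed up as high as possible). $\ell^{\mathrm a}_{lj}(\boldsymbol\lambda)$ is the level of the lowest bead (largest $\beta$-number) on runner $l$ of the abacus of $\lambda^{(j)}$. For a multicore $\boldsymbol\lambda$: $\gamma_i^{jk}(\boldsymbol\lambda)=\ell^{\mathrm a}_{ij}(\boldsymbol\lambda)-\ell^{\mathrm a}_{ik}(\boldsymbol\lambda)$ and $\gamma_{il}^{jk}(\boldsymbol\lambda)=\gamma_i^{jk}(\boldsymbol\lambda)-\gamma_l^{jk}(\boldsymbol\lambda)$ (the latter is independent of the multicharge $\mathrm a$). $s_{il}^{jk}(\boldsymbol\lambda)$ is the multicore whose abacus is obtained from that of $\boldsymbol\lambda$ by moving a bead from runner $i$ to runner $l$ in component $j$ and a bead from runner $l$ to runner $i$ in component $k$ (all beads again being pushed up as high as possible). Core blocks. A block is a core block if every multipartition in it is a multicore; equivalently, no block of any $\mathcal H_{r,m}$ (same $q,\kappa$) has the same hub and smaller weight. For each hub that occurs there is exactly one core block with that hub; the core block of a multipartition is the core block with the same hub. *)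

(* Defs.v *)
From HB Require Import structures.
From mathcomp Require Import all_boot all_order all_algebra.
Set Implicit Arguments.
Unset Strict Implicit.
Unset Printing Implicit Defensive.
Import Order.TTheory GRing.Theory Num.Theory.
Local Open Scope ring_scope.

Definition is_part (s : seq nat) : bool := sorted geq s && (0%N \notin s).

Record partition : Type := Partition {parts :> seq nat; partsP : is_part parts}.
HB.instance Definition _ := [isSub for parts].
HB.instance Definition _ := [Choice of partition by <:].

(* Rows are numbered from 1, and [part p b = 0] past the last row. *)
Definition part (p : partition) (b : nat) : nat := nth 0%N p b.-1.

Definition multipartition (r : nat) : Type := {ffun 'I_r -> partition}.

Definition msize r (la : multipartition r) : nat := (\sum_(j < r) sumn (la j))%N.

(* ((b, c), j) : row b >= 1, column c >= 1, component j. *)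
Definition node (r : nat) : Type := (nat * nat * 'I_r)%type.

Definition nodes r (la : multipartition r) : seq (node r) :=
  flatten [seq [seq ((b, c), j) | b <- iota 1 (size (la j)),
                                  c <- iota 1 (part (la j) b)]
          | j <- enum 'I_r].

(* The index set I is the ring 'Z_e, which is Z/eZ as soon as 1 < e. *)
Definition residue e r (ka : 'I_r -> int) (x : node r) : 'Z_e :=
  (ka x.2 + x.1.2%:Z - x.1.1%:Z)%:~R.

Definition residues e r (ka : 'I_r -> int) (la : multipartition r) : seq 'Z_e :=
  [seq residue e ka x | x <- nodes la].

(* Blocks of Ariki-Koike algebras: two multipartitions of n lie in the same block
   iff their multisets of residues coincide (Lyle-Mathas).  Equality of these
   multisets forces the sizes to agree, so n need not be mentioned. *)
Definition same_block e r (ka : 'I_r -> int) (la mu : multipartition r) : bool :=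
  perm_eq (residues e ka la) (residues e ka mu).

(* A block is identified with the set of multipartitions lying in it. *)
Definition is_block e r (ka : 'I_r -> int) (B : multipartition r -> Prop) : Prop :=
  exists la, forall mu, B mu <-> same_block e ka la mu.

Definition removable_nodes r (la : multipartition r) (j : 'I_r) : seq (node r) :=
  [seq ((b, part (la j) b), j)
  | b <- iota 1 (size (la j)) & (part (la j) b.+1 < part (la j) b)%N].

Definition addable_nodes r (la : multipartition r) (j : 'I_r) : seq (node r) :=
  [seq ((b, (part (la j) b).+1), j)
  | b <- iota 1 (size (la j)).+1
  & (b == 1%N) || (part (la j) b < part (la j) b.-1)%N].

Definition delta_comp e r (ka : 'I_r -> int) (la : multipartition r)
    (i : 'Z_e) (j : 'I_r) : int :=
  (count (fun x => residue e ka x == i) (removable_nodes la j))%:Z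
  - (count (fun x => residue e ka x == i) (addable_nodes la j))%:Z.

Definition hub e r (ka : 'I_r -> int) (la : multipartition r) (i : 'Z_e) : int :=
  \sum_(j < r) delta_comp ka la i j.

Definition res_count e r (ka : 'I_r -> int) (la : multipartition r) (i : 'Z_e) : nat :=
  count_mem i (residues e ka la).

Definition weight e r (ka : 'I_r -> int) (la : multipartition r) : rat :=
  \sum_(j < r) (res_count ka la ((ka j)%:~R : 'Z_e))%:R
  - 2^-1 * \sum_(i : 'Z_e)
             ((res_count ka la i)%:R - (res_count ka la (i + 1))%:R) ^+ 2.

Definition multicharge e r (ka a : 'I_r -> int) : Prop :=
  forall j, (a j = ka j %[mod e%:Z])%Z.

Definition beta (a : int) (p : partition) (m : nat) : int :=
  (part p m)%:Z + a - m%:Z.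

Definition bead (a : int) (p : partition) (x : int) : Prop :=
  exists2 m : nat, (0 < m)%N & x = beta a p m.

Definition is_core e (p : partition) : Prop :=
  forall a x : int, bead a p x -> bead a p (x - e%:Z).

Definition multicore e r (la : multipartition r) : Prop :=
  forall j, is_core e (la j).

(* The beta-numbers decrease with m, and the e consecutive ones that follow
   those of the nonzero parts meet every runner, so the first beta-number in
   this list that is on runner l is the largest one (lemma level_lowest). *)
Definition level e (a : int) (p : partition) (l : 'Z_e) : int :=
  head 0 [seq (beta a p m %/ e%:Z)%Z
         | m <- iota 1 (size p + e) & (beta a p m %% e%:Z)%Z == (l : nat)%:Z].

Definition gamma e r (a : 'I_r -> int) (la : multipartition r)
    (i : 'Z_e) (j k : 'I_r) : int :=
  level (a j) (la j) i - level (a k) (la k) i.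

Definition gamma2 e r (a : 'I_r -> int) (la : multipartition r)
    (i l : 'Z_e) (j k : 'I_r) : int :=
  gamma a la i j k - gamma a la l j k.

(* [is_swap a la i l j k mu] : mu is s_{il}^{jk}(la).  In the abacus of a core
   each runner is filled down to its lowest bead, so the core is determined by
   the levels, and moving a bead off (onto) a runner and pushing up lowers
   (raises) the level of that runner by one.  If i = l or j = k the two moves
   cancel. *)
Definition is_swap e r (a : 'I_r -> int) (la : multipartition r)
    (i l : 'Z_e) (j k : 'I_r) (mu : multipartition r) : Prop :=
  multicore e mu /\
  forall (h : 'Z_e) (y : 'I_r),
    level (a y) (mu y) h =
      level (a y) (la y) h
      + (y == j)%:Z * ((h == l)%:Z - (h == i)%:Z)
      + (y == k)%:Z * ((h == i)%:Z - (h == l)%:Z).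

Definition is_core_block e r (ka : 'I_r -> int) (B : multipartition r -> Prop) : Prop :=
  is_block e ka B /\ forall mu, B mu -> multicore e mu.

Definition is_core_block_of e r (ka : 'I_r -> int) (la : multipartition r)
    (B : multipartition r -> Prop) : Prop :=
  is_core_block e ka B /\
  forall mu, B mu -> forall i : 'Z_e, hub ka mu i = hub ka la i.

Lemma part_noninc (p : partition) (m n : nat) :
  (m <= n)%N -> (part p n <= part p m)%N.
Proof.
move=> mn; rewrite /part.
have [lt|ge] := ltnP n.-1 (size p); last by rewrite (nth_default _ ge).
have /andP[sp _] := partsP p.
have le : (m.-1 <= n.-1)%N by rewrite -!subn1 leq_sub2r.
apply: (sorted_leq_nth (leT := geq) _ _ 0%N sp) => //.
- by move=> x y z /= h1 h2; apply: leq_trans h2 h1.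
- by move=> x /=.
- by rewrite inE (leq_ltn_trans le lt).
Qed.

Lemma level_lowest e (a : int) (p : partition) (l : 'Z_e) : (1 < e)%N ->
  bead a p (level a p l * e%:Z + (l : nat)%:Z) /\
  forall x : int, bead a p (x * e%:Z + (l : nat)%:Z) -> x <= level a p l.
Proof.
move=> e_gt1.
have e_gt0 : (0 : int) < e%:Z by rewrite ltz_nat (ltn_trans _ e_gt1).
have e_neq0 : e%:Z != 0 by rewrite gt_eqF.
have l_lt : ((l : nat) < e)%N by rewrite -[X in (_ < X)%N](Zp_cast e_gt1).
rewrite /level; set P := fun m : nat => (beta a p m %% e%:Z)%Z == (l : nat)%:Z.
set s := [seq m <- iota 1 (size p + e) | P m].
have mem_s m : m \in s = P m && (1 <= m < 1 + (size p + e))%N.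
  by rewrite mem_filter mem_iota.
have [m ms] : exists m, m \in s.
  have r_ge0 : 0 <= ((a - (size p)%:Z - 1 - (l : nat)%:Z) %% e%:Z)%Z by exact: modz_ge0.
  have r_lt : ((a - (size p)%:Z - 1 - (l : nat)%:Z) %% e%:Z)%Z < e%:Z by exact: ltz_pmod.
  have dE := divz_eq (a - (size p)%:Z - 1 - (l : nat)%:Z) e%:Z.
  set r := modz _ _ in r_ge0 r_lt dE; set d := divz _ _ in dE.
  case: r => // r in r_ge0 r_lt dE *.
  rewrite ltz_nat in r_lt.
  exists (size p + r).+1; rewrite mem_s; apply/andP; split; last first.
    by rewrite /= add1n ltnS ltn_add2l.
  rewrite /P /beta /part nth_default ?leq_addr // add0r.
  have -> : a - (size p + r).+1%:Z = d * e%:Z + (l : nat)%:Z.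
    move/eqP: dE; rewrite -subr_eq0 => /eqP dE; apply/eqP; rewrite -subr_eq0; apply/eqP.
    rewrite -dE -addn1 !PoszD !opprD !addrA.
    by rewrite -!addrA; congr (_ + _); rewrite !addrA [LHS](ACl (1*3*5*4*2)).
  by rewrite modzMDl modz_small // ltz_nat l_lt.
case E : s ms => [//|m0 s'] _ /=.
have /andP[/eqP Pm0 /andP[m0_gt0 m0_le]] : P m0 && (1 <= m0 < 1 + (size p + e))%N.
  by rewrite -mem_s E mem_head.
split; first by exists m0 => //; rewrite -Pm0 -divz_eq.
move=> x [n n_gt0 xE].
have Pn : P n by rewrite /P -xE modzMDl modz_small // ltz_nat l_lt.
have m0n : (m0 <= n)%N.
  have [le|] := leqP n (size p + e); last first.
    by move=> lt; apply: leq_trans (ltnW lt); rewrite -ltnS -add1n.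
  have : n \in s by rewrite mem_s Pn n_gt0 add1n ltnS.
  have : sorted leq s.
    by apply: sorted_filter; [exact: leq_trans|exact: iota_sorted].
  rewrite E /= => /(order_path_min leq_trans)/allP le_s.
  by rewrite inE => /predU1P[->|/le_s].
have -> : x = (beta a p n %/ e%:Z)%Z.
  by rewrite -xE divzMDl // divz_small ?addr0 // ltz_nat l_lt.
apply: lez_pdiv2r; [exact: ltW|rewrite /beta; apply: lerB]; last by rewrite lez_nat.
by rewrite lerD2r lez_nat part_noninc.
Qed.

(* Main.v *)
(* In terms of the matrix X with entries X i j = level of runner i in component j,
   the column sums are determined by the charge, the hub by the row sums, and for a
   fixed hub the weight is r/2 times the energy sum (X i j)^2 plus a constant.  A swap
   adds to X a matrix S with four nonzero entries and changes the weight by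
   r (2 - gamma), so strictly decreasing swaps are available until all |gamma| <= 2.
   For the second phase, let Y be the matrix of a member of C and D = Y - X.  Some
   swap S satisfies <S, D> >= 3, and splitting D = S + (D - S) one shows by induction
   on |D|^2 that if Y has smaller energy than X then weakly decreasing swaps lead from
   X to strictly smaller energy.  Finally a multicore with the hub of C and energy at
   most that of Y lies in C: otherwise adding rim e-hooks to it would produce a member
   of C that is not a multicore. *)

Require Import Defs.
From mathcomp Require Import all_boot all_order all_algebra.
From mathcomp Require Import zify ring.
Import Order.TTheory GRing.Theory Num.Theory.
Local Open Scope ring_scope.
Set Implicit Arguments.
Unset Strict Implicit.
Unset Printing Implicit Defensive.

(** * Balanced integer matrices and swaps *)

Definition frobmx p q (A B : 'M[int]_(p, q)) : int := \sum_i \sum_j A i j * B i j.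

(** The change of the level matrix under a swap. As a product of row and column differences it
    vanishes by itself when [i = l] or [j = k]. *)
Definition swapmx p q (i l : 'I_p) (j k : 'I_q) : 'M[int]_(p, q) :=
  \matrix_(h, y) (((y == j)%:Z - (y == k)%:Z) * ((h == l)%:Z - (h == i)%:Z)).

(** These are the differences of level matrices of multicores with equal hubs: the charge fixes the
    column sums, the hub the row sums. *)
Definition balanced p q (D : 'M[int]_(p, q)) : Prop :=
  (forall i, \sum_j D i j = 0) /\ (forall j, \sum_i D i j = 0).

Lemma sum_delta n (x y : 'I_n) (F : 'I_n -> int) :
  \sum_z ((z == x)%:Z - (z == y)%:Z) * F z = F x - F y.
Proof.
under eq_bigr do rewrite mulrBl; rewrite sumrB.
rewrite (bigD1 x) //= eqxx mul1r big1 ?addr0; last by move=> z /negPf->; rewrite mul0r.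
by rewrite (bigD1 y) //= eqxx mul1r big1 ?addr0 // => z /negPf->; rewrite mul0r.
Qed.

Lemma frob_swapmx p q (i l : 'I_p) (j k : 'I_q) (D : 'M[int]_(p, q)) :
  frobmx (swapmx i l j k) D = D l j - D i j - (D l k - D i k).
Proof.
transitivity (\sum_h ((h == l)%:Z - (h == i)%:Z) * (D h j - D h k)).
  apply: eq_bigr => h _; rewrite -sum_delta mulr_sumr.
  by apply: eq_bigr => y _; rewrite !mxE; ring.
by rewrite sum_delta; ring.
Qed.

Lemma frobmxDl p q (A B D : 'M[int]_(p, q)) : frobmx (A + B) D = frobmx A D + frobmx B D.
Proof.
rewrite /frobmx -big_split; apply: eq_bigr => i _; rewrite -big_split.
by apply: eq_bigr => j _; rewrite !mxE mulrDl.
Qed.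

Lemma frobmxC p q (A B : 'M[int]_(p, q)) : frobmx A B = frobmx B A.
Proof. by apply: eq_bigr => i _; apply: eq_bigr => j _; rewrite mulrC. Qed.

Lemma frobmxNl p q (A D : 'M[int]_(p, q)) : frobmx (- A) D = - frobmx A D.
Proof.
rewrite /frobmx -sumrN; apply: eq_bigr => i _; rewrite -sumrN.
by apply: eq_bigr => j _; rewrite !mxE mulNr.
Qed.

Lemma frobmxNr p q (A D : 'M[int]_(p, q)) : frobmx A (- D) = - frobmx A D.
Proof. by rewrite frobmxC frobmxNl frobmxC. Qed.

Lemma frobmxx_ge0 p q (A : 'M[int]_(p, q)) : 0 <= frobmx A A.
Proof. by apply: sumr_ge0 => i _; apply: sumr_ge0 => j _; rewrite -expr2 sqr_ge0. Qed.

Lemma frobmx_sqD p q (A B : 'M[int]_(p, q)) :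
  frobmx (A + B) (A + B) = frobmx A A + 2 * frobmx A B + frobmx B B.
Proof. by rewrite frobmxDl ![frobmx _ (A + B)]frobmxC !frobmxDl [frobmx B A]frobmxC; ring. Qed.

Lemma balanced_swapmx p q (i l : 'I_p) (j k : 'I_q) : balanced (swapmx i l j k).
Proof.
split=> [h | y].
  transitivity (\sum_y ((y == j)%:Z - (y == k)%:Z) * ((h == l)%:Z - (h == i)%:Z)).
    by apply: eq_bigr => y _; rewrite mxE.
  by rewrite sum_delta subrr.
transitivity (\sum_h ((h == l)%:Z - (h == i)%:Z) * ((y == j)%:Z - (y == k)%:Z)).
  by apply: eq_bigr => h _; rewrite mxE mulrC.
by rewrite sum_delta subrr.
Qed.

Lemma balancedB p q (D E : 'M[int]_(p, q)) :
  balanced D -> balanced E -> balanced (D - E).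
Proof.
move=> [rD cD] [rE cE]; split=> [i | j].
  by under eq_bigr do rewrite !mxE; rewrite sumrB rD rE subrr.
by under eq_bigr do rewrite !mxE; rewrite sumrB cD cE subrr.
Qed.

(** If some [d j] were at least [c + 1], every other entry would be nonnegative, and the sum
    positive. *)
Lemma sum0_le_spread n (d : 'I_n -> int) (c : int) : 0 <= c ->
  \sum_j d j = 0 -> (forall j k, d j - d k <= c + 1) -> forall j, d j <= c.
Proof.
move=> c0 sd0 dc j; rewrite leNgt; apply/negP => cj.
have d_ge0 k : 0 <= d k by have := dc j k; lia.
have : 0 <= \sum_(k | k != j) d k by apply: sumr_ge0.
by move: sd0; rewrite (bigD1 j) //=; set S := \sum_(_ | _) _; lia.
Qed.

(* Otherwise any two rows of D differ by a vector with sum 0 and spread at most 2,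
   hence with entries in {-1, 0, 1}; so the columns have sum 0 and spread at
   most 1, which forces D = 0. *)
Lemma balanced_exists_swap p q (D : 'M[int]_(p, q)) : balanced D -> D != 0 ->
  exists i l j k, 3 <= frobmx (swapmx i l j k) D.
Proof.
move=> [rD cD] /eqP D0.
case: (boolP [exists i, exists l, exists j, exists k, 3 <= frobmx (swapmx i l j k) D]).
  move=> /existsP[i /existsP[l /existsP[j /existsP[k h]]]].
  by exists i, l, j, k.
move=> /existsPn nex; case: D0.
have dotD i l j k : D l j - D i j - (D l k - D i k) <= 2.
  rewrite -frob_swapmx; have := nex i; move=> /existsPn/(_ l)/existsPn/(_ j)/existsPn/(_ k).
  by lia.
have col i l j : D l j - D i j <= 1.
  apply: (sum0_le_spread (d := fun j => D l j - D i j)) => //.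
  by rewrite sumrB !rD subrr.
apply/matrixP => i j; rewrite mxE; apply: le_anti; apply/andP; split.
  by apply: (sum0_le_spread (d := fun i => D i j)) => // x y; have := col y x j; lia.
rewrite -oppr_le0.
apply: (sum0_le_spread (d := fun i => - D i j)) => [//||x y].
  by rewrite sumrN cD oppr0.
by have := col x y j; lia.
Qed.

(** A nonzero inner product excludes [i = l] and [j = k], which leaves four nonzero entries, each 1
    or -1. *)
Lemma frob_swapmxx p q (i l : 'I_p) (j k : 'I_q) (D : 'M[int]_(p, q)) :
  frobmx (swapmx i l j k) D != 0 -> frobmx (swapmx i l j k) (swapmx i l j k) = 4.
Proof.
rewrite !frob_swapmx; case: (eqVneq i l) => [->|il]; first by rewrite !subrr.
case: (eqVneq j k) => [->|jk]; first by rewrite !subrr.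
by rewrite !mxE !eqxx ![l == i]eq_sym ![k == j]eq_sym (negPf il) (negPf jk).
Qed.

(** * Chains of steps *)

Section Chain.
Variable T : Type.
Implicit Type R : T -> T -> Prop.

Definition chain R (x y : T) : Prop :=
  exists (s : nat) (f : nat -> T),
    [/\ f 0%N = x, f s = y & forall t, (t < s)%N -> R (f t) (f t.+1)].

Lemma chain_refl R x : chain R x x.
Proof. by exists 0%N, (fun=> x). Qed.

Lemma chain_cons R x y z : R x y -> chain R y z -> chain R x z.
Proof.
move=> xy [s [f [f0 fs fR]]]; exists s.+1, (fun t => if t is t'.+1 then f t' else x).
by split=> // -[_|t]; [rewrite f0|exact: fR].
Qed.

Lemma chain_trans R x y z : chain R x y -> chain R y z -> chain R x z.
Proof.
move=> [s [f [<- <- fR]]] c; elim: s f fR c => [//|s IH] f fR c.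
apply: chain_cons (fR 0%N _) _ => //.
by apply: (IH (fun t => f t.+1)) => // t ts; apply: fR.
Qed.
End Chain.

(** * Descent of the energy along swaps *)

Section Descent.
Variables (T : Type) (p q : nat) (P : T -> Prop) (lev : T -> 'M[int]_(p, q)).

Definition energy (x : T) : int := frobmx (lev x) (lev x).

Definition swapped (x y : T) : Prop :=
  P y /\ exists i l j k, lev y = lev x + swapmx i l j k.

Definition strict_swap (x y : T) : Prop := swapped x y /\ energy y < energy x.

Definition weak_swap (x y : T) : Prop := swapped x y /\ energy y <= energy x.

Hypothesis swap_exists : forall x i l j k, P x ->
  exists2 y, P y & lev y = lev x + swapmx i l j k.

Lemma energy_ge0 x : 0 <= energy x.
Proof. exact: frobmxx_ge0. Qed.

(** Each step adds a matrix with zero row and column sums; for multicores this means that the hub is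
    kept. *)
Lemma chain_swapped R x y : (forall u v, R u v -> swapped u v) -> P x ->
  chain R x y -> P y /\ balanced (lev y - lev x).
Proof.
move=> Rs Px [s [f [f0 fs fR]]]; rewrite -fs.
elim: s {fs} fR => [_|s IH fR].
  rewrite f0 subrr; split=> //; split=> [i|j]; by rewrite big1 // => ? _; rewrite mxE.
have [t ts|_ b] := IH; first exact: fR (ltnW ts).
have [Py [i [l [j [k ->]]]]] := Rs _ _ (fR s (ltnSn s)); split=> //.
rewrite addrAC -[X in _ + X]opprK; apply: balancedB => //.
suff -> : - swapmx i l j k = swapmx l i j k by exact: balanced_swapmx.
by apply/matrixP => h z; rewrite !mxE; ring.
Qed.

(** A swap [S] with [<S, X> < -2] changes the energy by [2 <S, X> + 4 < 0]; the energy is a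
    nonnegative integer, so such swaps run out. *)
Lemma strict_chain x : P x -> exists2 y, chain strict_swap x y &
  forall i l j k, -2 <= frobmx (swapmx i l j k) (lev y).
Proof.
have [N] := ubnP `|energy x|%N; elim: N x => // N IH x xN Px.
case: (boolP [exists i, exists l, exists j, exists k,
   frobmx (swapmx i l j k) (lev x) < -2]).
  move=> /existsP[i /existsP[l /existsP[j /existsP[k h]]]].
  have [y Py yE] := swap_exists i l j k Px.
  have yx : energy y < energy x.
    rewrite /energy yE frobmx_sqD (frob_swapmxx (D := lev x)); last by lia.
    by rewrite [frobmx (lev x) (swapmx _ _ _ _)]frobmxC; lia.
  have [|//|z yz zP] := IH y; first by have := energy_ge0 y; lia.
  exists z => //; apply: chain_cons yz; split=> //; split=> //.
  by exists i, l, j, k.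
move=> /existsPn nex; exists x; first exact: chain_refl.
move=> i l j k; have := nex i => /existsPn/(_ l)/existsPn/(_ j)/existsPn/(_ k).
by rewrite -leNgt.
Qed.

(* With <S, D> >= 3 the energies satisfy
   f(X + S) + f(X + D - S) = f(X) + f(X + D) - 2 <S, D> + 8 <= 2 f(X) + 1,
   while f(X + S) - f(X) = 2 <S, X> + 4 is even.  Hence S or D - S lowers the
   energy, or S preserves it and D - S then lowers it from X + S.  The norm of
   D - S is smaller than that of D. *)
Lemma weak_chain_lt x D : P x -> balanced D ->
  frobmx (lev x + D) (lev x + D) < energy x ->
  exists2 y, chain weak_swap x y & energy y < energy x.
Proof.
have [N] := ubnP `|frobmx D D|%N; elim: N x D => // N IH x D DN Px bD lt.
have D0 : D != 0.
  by apply/eqP => D0; move: lt; rewrite D0 addr0 /energy ltxx.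
have [i [l [j [k]]]] := balanced_exists_swap bD D0.
set S := swapmx i l j k => SD.
have SS : frobmx S S = 4 by apply: (frob_swapmxx (D := D)); move: SD; rewrite -/S; lia.
have DS : frobmx (D - S) (D - S) = frobmx D D - 2 * frobmx S D + 4.
  by rewrite frobmx_sqD frobmxNl !frobmxNr SS [frobmx D S]frobmxC; ring.
have DSN : (`|frobmx (D - S) (D - S)| < N)%N.
  by have := frobmxx_ge0 (D - S); lia.
have bDS : balanced (D - S) by apply: balancedB => //; exact: balanced_swapmx.
have [y Py yE] := swap_exists i l j k Px; rewrite -/S in yE.
have sw : swapped x y by split=> //; exists i, l, j, k.
have yF : energy y = energy x + 2 * frobmx S (lev x) + 4.
  by rewrite /energy yE frobmx_sqD SS [frobmx (lev x) S]frobmxC.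
case: (ltrP (energy y) (energy x)) => [yx|xy].
  by exists y => //; apply: chain_cons (chain_refl _ _); split=> //; exact: ltW.
have [DSx|xDS] := ltrP (frobmx (lev x + (D - S)) (lev x + (D - S))) (energy x).
  exact: (IH x (D - S)).
have yx : energy y = energy x.
  move: xDS lt xy; rewrite !(frobmx_sqD (lev x)) DS yF.
  rewrite [frobmx (lev x) (D - S)]frobmxC frobmxDl frobmxNl [frobmx D (lev x)]frobmxC.
  by rewrite -/(energy x); lia.
have [|z yz zy] := IH y (D - S) DSN Py bDS; last exists z.
- by rewrite yE [D - S]addrC addrA addrK yx.
- by apply: chain_cons yz; split=> //; rewrite yx.
- by rewrite -yx.
Qed.

(** [weak_chain_lt] is repeated with the same target [Y]: the difference from the new point stays
    balanced, and the energy drops each time. *)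
Lemma weak_chain_le x (Y : 'M[int]_(p, q)) : P x -> balanced (Y - lev x) ->
  exists2 y, chain weak_swap x y & energy y <= frobmx Y Y.
Proof.
have [N] := ubnP `|energy x|%N; elim: N x => // N IH x xN Px bY.
have [le|lt] := lerP (energy x) (frobmx Y Y).
  by exists x => //; exact: chain_refl.
have [|z xz zx] := weak_chain_lt Px bY; first by rewrite addrC subrK.
have [Pz bz] := chain_swapped (fun u v h => proj1 h) Px xz.
have [|//||y zy yY] := IH z; first by have := energy_ge0 z; lia.
  by have -> : Y - lev z = Y - lev x - (lev z - lev x);
    [rewrite opprB addrA subrK|exact: balancedB].
by exists y => //; exact: chain_trans zy.
Qed.
End Descent.

(** * Residue counts and the hub *)

Lemma Posz_sum (I : Type) (s : seq I) (P : pred I) (F : I -> nat) :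
  (\sum_(x <- s | P x) F x)%N%:Z = \sum_(x <- s | P x) (F x)%:Z.
Proof. exact: (big_morph Posz PoszD). Qed.

Lemma count_iota1 (P : pred nat) n :
  (count P (iota 1 n))%:Z = \sum_(b < n) (P b.+1)%:Z.
Proof.
elim: n => [|n IH]; first by rewrite big_ord0.
by rewrite -[X in iota 1 X]addn1 iotaD count_cat PoszD IH big_ord_recr /= addn0 add1n.
Qed.

Lemma ord_Zp_lt e (i : 'Z_e) : (1 < e)%N -> (i < e)%N.
Proof. by move=> he; rewrite -[X in (_ < X)%N](Zp_cast he). Qed.

Lemma intr_Zp_eq e (z : int) (i : 'Z_e) : (1 < e)%N ->
  (z%:~R == i) = (e%:Z %| z - (i : nat)%:Z)%Z.
Proof.
move=> he; have ie := ord_Zp_lt i he.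
have eE : (e%:Z)%:~R = 0 :> 'Z_e by rewrite -pmulrn pchar_Zp.
have z0 : 0 <= (z %% e%:Z)%Z by apply: modz_ge0; lia.
have ze : (z %% e%:Z)%Z < e%:Z by apply: ltz_pmod; lia.
rewrite -eqz_mod_dvd [RHS]/eq_op /= {1}(divz_eq z e%:Z) rmorphD rmorphM /=.
rewrite eE mulr0 add0r (@modz_small i%:Z) //.
move: z0 ze; case: (z %% e%:Z)%Z => // x _; rewrite ltz_nat => xe.
rewrite -pmulrn Zp_nat -val_eqE /= modn_small //.
by rewrite Zp_cast.
Qed.

Definition row_count e (a : int) (n : nat) (i : 'Z_e) : nat :=
  count (fun c : nat => (a + c%:Z)%:~R == i) (iota 1 n).

Definition comp_count e (a : int) (p : Defs.partition) (i : 'Z_e) : nat :=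
  (\sum_(b < size p) row_count (a - b.+1%:Z) (part p b.+1) i)%N.

Lemma part_size (p : Defs.partition) (b : nat) : (size p < b)%N -> part p b = 0%N.
Proof. by move=> pb; rewrite /part nth_default //; case: b pb. Qed.

Lemma comp_countE e a (p : Defs.partition) (i : 'Z_e) N : (size p <= N)%N ->
  comp_count a p i = (\sum_(b < N) row_count (a - b.+1%:Z) (part p b.+1) i)%N.
Proof.
move=> pN; rewrite -(subnKC pN) big_split_ord /= [X in (_ + X)%N]big1 ?addn0 //.
by move=> b _; rewrite part_size //= ltnS leq_addr.
Qed.

Lemma res_countE e r (ka : 'I_r -> int) (la : multipartition r) (i : 'Z_e) :
  res_count ka la i = (\sum_(j < r) comp_count (ka j) (la j) i)%N.
Proof.
rewrite /res_count /residues count_map /nodes count_flatten -map_comp sumnE big_map.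
rewrite big_enum /=; apply: eq_bigr => j _.
rewrite count_flatten -map_comp sumnE big_map /comp_count.
have -> : iota 1 (size (la j)) = index_iota 1 (size (la j)).+1 by rewrite /index_iota subn1.
rewrite big_add1 /= big_mkord.
apply: eq_bigr => b _; rewrite /= count_map; apply: eq_count => c /=.
by rewrite /residue /=; congr (_%:~R == _); ring.
Qed.

(** Column [c + 1] has residue [i + 1] exactly when column [c] has residue [i], so the difference
    telescopes along the row. *)
Lemma row_count_diff e a n (i : 'Z_e) :
  (row_count a n i)%:Z - (row_count a n (i + 1))%:Z
  = ((a + n%:Z)%:~R == i)%:Z - (a%:~R == i)%:Z.
Proof.
rewrite /row_count !count_iota1; elim: n => [|n IH].
  by rewrite !big_ord0 [a + _]addr0 !subrr.
rewrite !big_ord_recr /= opprD addrACA IH.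
have -> : ((a + n.+1%:Z)%:~R == i + 1) = ((a + n%:Z)%:~R == i).
  by rewrite -addn1 PoszD addrA rmorphD /= (inj_eq (addIr _)).
by ring.
Qed.

(** Summing the telescoped rows compares the beads congruent to [i] among the first [N] with those
    of the empty partition. *)
Lemma comp_count_diff e a (p : Defs.partition) (i : 'Z_e) N : (size p <= N)%N ->
  (comp_count a p i)%:Z - (comp_count a p (i + 1))%:Z
  = \sum_(b < N) ((beta a p b.+1)%:~R == i)%:Z
    - \sum_(b < N) ((a - b.+1%:Z)%:~R == i)%:Z.
Proof.
move=> pN; rewrite !(comp_countE _ _ pN) !Posz_sum -!sumrB; apply: eq_bigr => b _.
by rewrite row_count_diff /beta; congr ((_%:~R == _)%:Z - _); ring.
Qed.

(* Row b is non-removable exactly when row b + 1 is non-addable, and then the two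
   nodes concerned have the same residue; so removable minus addable can be counted
   over all rows. *)
Lemma delta_compE e r (ka : 'I_r -> int) (la : multipartition r) (i : 'Z_e) j :
  delta_comp ka la i j
  = (comp_count (ka j) (la j) i)%:Z *+ 2 - (comp_count (ka j) (la j) (i - 1))%:Z
    - (comp_count (ka j) (la j) (i + 1))%:Z - ((ka j)%:~R == i)%:Z.
Proof.
set p := la j; set a := ka j; set N := size p.
have iS x : (x%:~R == i - 1) = ((x + 1)%:~R == i :> 'Z_e).
  by rewrite rmorphD /= -[LHS]subr_eq opprK.
have tele n : \sum_(b < n) ((a - b.+1%:Z)%:~R == i)%:Z
    = \sum_(b < n) ((a - b.+1%:Z)%:~R == i - 1)%:Z
      + ((a - n%:Z)%:~R == i)%:Z - (a%:~R == i)%:Z.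
  elim: n => [|n IH]; first by rewrite !big_ord0 subr0; ring.
  rewrite !big_ord_recr /= IH iS.
  have -> : a - n.+1%:Z + 1 = a - n%:Z by lia.
  by ring.
have D0 := comp_count_diff a i (leqnn N).
have D1 := comp_count_diff a (i - 1) (leqnn N).
rewrite subrK in D1.
(* Rows [b + 1] and [b + 2] have equal length: the former is not removable and the latter not
   addable. *)
pose stuck b := part p b.+2 == part p b.+1.
have rem : (count (fun x => residue e ka x == i) (removable_nodes la j))%:Z
    = \sum_(b < N) ((beta a p b.+1)%:~R == i)%:Z
      - \sum_(b < N) (stuck b && ((beta a p b.+1)%:~R == i))%:Z.
  rewrite /removable_nodes count_map count_filter count_iota1 -sumrB.
  apply: eq_bigr => b _ /=; rewrite /residue /= -/p -/a /stuck.
  have -> : a + (part p b.+1)%:Z - b.+1%:Z = beta a p b.+1 by rewrite /beta; ring.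
  have := @part_noninc p b.+1 b.+2 (leqnSn _).
  by rewrite ltn_neqAle => ->; case: (_ == i); case: (part p b.+2 == _).
have add : (count (fun x => residue e ka x == i) (addable_nodes la j))%:Z
    = \sum_(b < N.+1) ((beta a p b.+1)%:~R == i - 1)%:Z
      - \sum_(b < N) (stuck b && ((beta a p b.+1)%:~R == i))%:Z.
  rewrite /addable_nodes count_map count_filter count_iota1 -/p -/a -/N.
  rewrite !big_ord_recl /= -addrA; congr (_ + _).
    rewrite andbT /residue /= iS -/a; congr ((_%:~R == _)%:Z).
    by rewrite /beta; lia.
  rewrite -sumrB; apply: eq_bigr => b _; rewrite /residue /= /bump /= add1n -/a /stuck.
  have -> : a + (part p b.+2).+1%:Z - b.+2%:Z = beta a p b.+2 + 1 by rewrite /beta; lia.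
  have := @part_noninc p b.+1 b.+2 (leqnSn _).
  rewrite iS ltn_neqAle => ->; have [E|] := eqVneq (part p b.+2); last first.
    by case: (_ == i).
  have -> : beta a p b.+1 = beta a p b.+2 + 1 by rewrite /beta E; lia.
  by case: (_ == i).
(* Row [N + 1] is empty and always addable; its term cancels the boundary term of [tele]. *)
have last_row : ((beta a p N.+1)%:~R == i - 1 :> 'Z_e) = ((a - N%:Z)%:~R == i).
  by rewrite iS /beta part_size //; congr (_%:~R == _); lia.
rewrite /delta_comp rem add big_ord_recr /= last_row.
rewrite mulr2n; move: D0 D1 (tele N) => /eqP; rewrite subr_eq => /eqP-> /eqP.
by rewrite subr_eq => /eqP-> ->; ring.
Qed.

(** A discrete Laplacian on the cycle of residues, applied to the residue counts, with a correction
    depending only on [ka]. *)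
Lemma hubE e r (ka : 'I_r -> int) (la : multipartition r) (i : 'Z_e) :
  hub ka la i = (res_count ka la i)%:Z *+ 2 - (res_count ka la (i - 1))%:Z
    - (res_count ka la (i + 1))%:Z - \sum_(j < r) ((ka j)%:~R == i)%:Z.
Proof.
rewrite /hub !res_countE !Posz_sum -sumrMnl -!sumrB.
by apply: eq_bigr => j _; rewrite delta_compE.
Qed.

Lemma Zp_shift_const (T : Type) e (u : 'Z_e -> T) :
  (forall i, u (i + 1) = u i) -> forall i, u i = u 0.
Proof.
move=> uS i; rewrite -(natr_Zp i).
by elim: (i : nat) => [//|n IH]; rewrite -natr1 uS.
Qed.

Lemma Zp_sum_shift e (u : 'Z_e -> int) : \sum_i u (i + 1) = \sum_i u i.
Proof. by rewrite [RHS](reindex_inj (addIr 1)). Qed.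

(** The successive differences are all equal, and their sum around the cycle is zero, so they
    vanish. *)
Lemma Zp_harmonic_const e (u : 'Z_e -> int) :
  (forall i, u i *+ 2 = u (i - 1) + u (i + 1)) -> forall i, u i = u 0.
Proof.
move=> uh; pose d i := u i - u (i + 1).
have d_const : forall i, d i = d 0.
  apply: Zp_shift_const => i; rewrite /d; have := uh (i + 1); rewrite addrK.
  set x := u _; set y := u _; set z := u _; lia.
have /eqP : \sum_(i : 'Z_e) d i = 0 by rewrite sumrB Zp_sum_shift subrr.
rewrite (eq_bigr (fun=> d 0)) // sumr_const card_ord mulrn_eq0 /= => /eqP d0.
apply: Zp_shift_const => i; apply/eqP; rewrite eq_sym -subr_eq0; apply/eqP.
by rewrite -/(d i) d_const.
Qed.

(** By [hubE], equal hubs make the difference of the residue counts harmonic on the cycle, hence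
    constant. *)
Lemma hub_eq_shift e r (ka : 'I_r -> int) (la mu : multipartition r) :
  (forall i : 'Z_e, hub ka la i = hub ka mu i) <->
  (exists h : int, forall i : 'Z_e,
      (res_count ka la i)%:Z = (res_count ka mu i)%:Z + h).
Proof.
split=> [hE | [h cE] i]; last by rewrite !hubE !cE; ring.
pose u (i : 'Z_e) := (res_count ka la i)%:Z - (res_count ka mu i)%:Z.
exists (u 0) => i; suff <- : u i = u 0 by rewrite /u; ring.
move: i; apply: Zp_harmonic_const => i; have := hE i; rewrite !hubE /u; lia.
Qed.

(** The squared differences are unchanged, and each of the [r] components contributes [h] to the
    first sum. *)
Lemma weight_shift e r (ka : 'I_r -> int) (la mu : multipartition r) (h : int) :
  (forall i : 'Z_e, (res_count ka la i)%:Z = (res_count ka mu i)%:Z + h) ->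
  weight e ka la = weight e ka mu + (r%:Z * h)%:~R.
Proof.
move=> cE.
have cR (i : 'Z_e) : (res_count ka la i)%:R = (res_count ka mu i)%:R + h%:~R :> rat.
  by rewrite !pmulrn -rmorphD /= -cE.
rewrite /weight; under [X in _ - _ * X]eq_bigr do rewrite !cR opprD addrACA subrr addr0.
under [X in X - _]eq_bigr do rewrite cR.
rewrite big_split /= sumr_const card_ord rmorphM /= -pmulrn mulr_natl.
by rewrite addrAC.
Qed.

(** * Abaci of cores *)

Lemma bead_shift (a d : int) (p : Defs.partition) (x : int) :
  bead (a + d) p (x + d) <-> bead a p x.
Proof. by split=> -[m m0 xE]; exists m => //; move: xE; rewrite /beta; lia. Qed.

Lemma is_core_bead e (a : int) (p : Defs.partition) :
  is_core e p <-> (forall x, bead a p x -> bead a p (x - e%:Z)).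
Proof.
split=> [h x|h a' x]; first exact: h.
rewrite -(bead_shift a' (a - a')) addrC subrK => /h.
by rewrite -[X in _ -> X](bead_shift a' (a - a')) [a' + _]addrC subrK addrAC.
Qed.

Lemma level_unique e (a : int) (p : Defs.partition) (l : 'Z_e) (y : int) : (1 < e)%N ->
  bead a p (y * e%:Z + (l : nat)%:Z) ->
  (forall x : int, bead a p (x * e%:Z + (l : nat)%:Z) -> x <= y) ->
  level a p l = y.
Proof.
move=> he By ymax; have [Bl lmax] := level_lowest a p l he.
by apply: le_anti; rewrite ymax // lmax.
Qed.

Lemma level_shift e (a c : int) (p : Defs.partition) (l : 'Z_e) : (1 < e)%N ->
  level (a + c * e%:Z) p l = level a p l + c.
Proof.
move=> he; have [Bl lmax] := level_lowest a p l he.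
apply: level_unique => // [|x].
  by rewrite mulrDl addrAC bead_shift.
have -> : x * e%:Z + (l : nat)%:Z = (x - c) * e%:Z + (l : nat)%:Z + c * e%:Z by ring.
by rewrite bead_shift => /lmax; lia.
Qed.

Lemma core_bead e (a : int) (p : Defs.partition) (l : 'Z_e) (y : int) : (1 < e)%N ->
  is_core e p -> bead a p (y * e%:Z + (l : nat)%:Z) <-> y <= level a p l.
Proof.
move=> he cp; have [Bl lmax] := level_lowest a p l he; split=> [/lmax //|yl].
have -> : y = level a p l - `|level a p l - y|%N%:Z by lia.
elim: `|_|%N => [|n IH]; first by rewrite subr0.
have /cp := IH.
by congr bead; rewrite intS; ring.
Qed.

(* The N largest beta-numbers for the charge N, which are natural numbers. *)
Definition beta_seq (N : nat) (p : Defs.partition) : seq nat :=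
  [seq (part p b.+1 + (N - b.+1))%N | b <- iota 0 N].

Lemma beta_seq_uniq N (p : Defs.partition) : uniq (beta_seq N p).
Proof.
rewrite map_inj_in_uniq ?iota_uniq // => b c; rewrite !mem_iota !add0n /= => bN cN.
wlog bc : b c bN cN / (b <= c)%N.
  by move=> W; case/orP: (leq_total b c) => [/W|/W W' /esym/W' <-]; auto.
by have := @part_noninc p b.+1 c.+1 bc; lia.
Qed.

Lemma bead_low (a : int) (p : Defs.partition) (N : nat) (x : int) :
  (size p <= N)%N -> x < a - N%:Z -> bead a p x.
Proof.
move=> pN xa; exists `|a - x|%N; first by lia.
by rewrite /beta part_size; lia.
Qed.

Lemma mem_beta_seq (a : int) (p : Defs.partition) (N y : nat) :
  (size p <= N)%N -> (y \in beta_seq N p) <-> bead a p (y%:Z + a - N%:Z).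
Proof.
move=> pN; split=> [/mapP[b] | [m m0 yE]].
  by rewrite mem_iota add0n /= => bN ->; exists b.+1 => //; rewrite /beta; lia.
have mN : (m <= N)%N.
  rewrite leqNgt; apply/negP => Nm; move: yE.
  by rewrite /beta part_size ?(leq_ltn_trans pN) //; lia.
apply/mapP; exists m.-1; first by rewrite mem_iota; lia.
by move: yE; rewrite /beta prednK //; lia.
Qed.

(** The bead positions when runner [l] carries [b l] beads, filling the levels from 0 on. *)
Definition runner_seq e (b : 'Z_e -> nat) : seq nat :=
  [seq (y * e + l)%N | l : 'Z_e <- enum 'Z_e, y <- iota 0 (b l)].

Lemma Zp_edivn e (he : (1 < e)%N) (x : nat) : 
  exists l : 'Z_e, x = (x %/ e * e + l)%N.
Proof.
have xe : (x %% e < (Zp_trunc e).+2)%N by rewrite Zp_cast // ltn_mod ltnW.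
by exists (Ordinal xe); rewrite /= -divn_eq.
Qed.

Lemma edivn_inj e (y z l k : nat) : (l < e)%N -> (k < e)%N ->
  (y * e + l = z * e + k)%N -> y = z /\ l = k.
Proof.
move=> le ke E; have e0 : (0 < e)%N by case: e le {ke E}.
split.
  by have := congr1 (divn^~ e) E; rewrite /= !divnMDl // !divn_small // !addn0.
by have := congr1 (modn^~ e) E; rewrite /= !modnMDl !modn_small.
Qed.

Lemma mem_runner_seq e (b : 'Z_e -> nat) (y : nat) (l : 'Z_e) : (1 < e)%N ->
  ((y * e + l)%N \in runner_seq b) = (y < b l)%N.
Proof.
move=> he; apply/idP/idP => [/allpairsPdep[k [z [_]]]|yb].
  rewrite mem_iota add0n /= => zb /edivn_inj[]; [exact: ord_Zp_lt..|].
  by move=> -> /val_inj ->.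
by apply/allpairsPdep; exists l, y; rewrite mem_enum mem_iota.
Qed.

Lemma runner_seq_uniq e (b : 'Z_e -> nat) : (1 < e)%N -> uniq (runner_seq b).
Proof.
move=> he; apply: allpairs_uniq_dep; first exact: enum_uniq.
  by move=> l _; exact: iota_uniq.
move=> [l y] [k z] /= _ _ /edivn_inj[]; [exact: ord_Zp_lt..|].
by move=> -> /val_inj ->.
Qed.

(** All positions below [a - N = - K e] carry beads, so every runner is full at the levels less than
    [- K]. *)
Lemma level_ge e (a : int) (p : Defs.partition) (K N : nat) (l : 'Z_e) : (1 < e)%N ->
  is_core e p -> N%:Z = a + K%:Z * e%:Z -> (size p <= N)%N ->
  - K%:Z - 1 <= level a p l.
Proof.
move=> he cp NE pN; rewrite -(core_bead a) //; apply: bead_low pN _; rewrite NE.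
have := ord_Zp_lt l he; lia.
Qed.

(** Since [N - a] is [K e], passing from charge [a] to [N] keeps the runners and adds [K] to the
    levels; runner [l] then has [level + K + 1] beads from level 0 on. *)
Lemma core_beta_seq e (a : int) (p : Defs.partition) (K N : nat) : (1 < e)%N ->
  is_core e p -> N%:Z = a + K%:Z * e%:Z -> (size p <= N)%N ->
  perm_eq (beta_seq N p) (runner_seq (fun l : 'Z_e => `|(level a p l + K%:Z + 1)%R|%N)).
Proof.
move=> he cp NE pN.
apply: uniq_perm; [exact: beta_seq_uniq|exact: runner_seq_uniq|] => x.
have [l ->] := Zp_edivn he x; set y := (x %/ e)%N; rewrite mem_runner_seq //.
have lK := level_ge l he cp NE pN.
have xE : (y * e + l)%N%:Z + a - N%:Z = (y%:Z - K%:Z) * e%:Z + (l : nat)%:Z.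
  by rewrite NE PoszD PoszM; ring.
apply/idP/idP => [|yl].
  by move/(mem_beta_seq a _ pN); rewrite xE core_bead //; lia.
by apply/(mem_beta_seq a _ pN); rewrite xE core_bead //; lia.
Qed.

Lemma sum_runner_seq e (b : 'Z_e -> nat) (g : nat -> int) :
  \sum_(x <- runner_seq b) g x = \sum_(l : 'Z_e) \sum_(y < b l) g (y * e + l)%N.
Proof.
rewrite /runner_seq big_flatten big_map big_enum; apply: eq_bigr => l _.
by rewrite big_map -[b l in LHS]subn0 -/(index_iota 0 (b l)) big_mkord.
Qed.

Lemma size_runner_seq e (b : 'Z_e -> nat) :
  size (runner_seq b) = (\sum_(l : 'Z_e) b l)%N.
Proof.
rewrite size_allpairs_dep sumnE big_map big_enum; apply: eq_bigr => l _.
by rewrite size_iota.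
Qed.

Lemma sum_Zp_const e (c : int) : (1 < e)%N -> \sum_(l : 'Z_e) c = e%:Z * c.
Proof. by move=> he; rewrite sumr_const card_ord Zp_cast // -mulr_natl natz. Qed.

(** The sum of [level + K + 1] over the [e] runners counts the [N = a + K e] beads. *)
Lemma sum_level e (a : int) (p : Defs.partition) : (1 < e)%N -> is_core e p ->
  \sum_(l : 'Z_e) level a p l = a - e%:Z.
Proof.
move=> he cp; pose K := (size p + `|a|)%N.
have [N NE] : exists N : nat, N%:Z = a + K%:Z * e%:Z by exists `|(a + K%:Z * e%:Z)%R|%N; nia.
have pN : (size p <= N)%N by nia.
have := perm_size (core_beta_seq he cp NE pN); rewrite size_map size_iota size_runner_seq.
move=> /(congr1 Posz); rewrite Posz_sum NE.
under eq_bigr => l _ do (have -> : `|(level a p l + K%:Z + 1)%R|%N%:Z = level a p l + (K%:Z + 1)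
  by have := level_ge l he cp NE pN; lia).
rewrite big_split /= (sum_Zp_const _ he) => /eqP.
by rewrite -subr_eq => /eqP <-; ring.
Qed.

(** * Residue counts of a core in terms of its levels *)

Lemma divzS (d z : int) : 0 < d ->
  ((z + 1) %/ d)%Z = (z %/ d)%Z + (d %| z + 1)%Z%:Z.
Proof.
move=> d0; have zE := divz_eq z d; have := ltz_pmod z d0.
have := @modz_ge0 z d; move: zE; set q := (z %/ d)%Z; set s := (z %% d)%Z.
move=> zE /(_ (lt0r_neq0 d0)) s0 sd.
have [sE|sN] := eqVneq (s + 1) d.
  have -> : z + 1 = (q + 1) * d by rewrite zE -addrA sE; ring.
  by rewrite dvdz_mull ?dvdzz // mulzK ?lt0r_neq0.
have -> : z + 1 = q * d + (s + 1) by rewrite addrA -zE.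
have sd1 : 0 <= s + 1 < d by move/eqP: sN; lia.
rewrite divzMDl ?lt0r_neq0 // divz_small; last by lia.
suff /negPf-> : ~~ (d %| q * d + (s + 1))%Z by [].
apply/negP => /dvdz_mod0P; rewrite modzMDl modz_small //; lia.
Qed.

(** As the column advances by one, the floor grows by one exactly at the nodes of residue [i]. *)
Lemma row_countE e (a : int) (n : nat) (i : 'Z_e) : (1 < e)%N ->
  (row_count a n i)%:Z
  = ((a + n%:Z - (i : nat)%:Z) %/ e%:Z)%Z - ((a - (i : nat)%:Z) %/ e%:Z)%Z.
Proof.
move=> he; rewrite /row_count count_iota1; elim: n => [|n IH].
  by rewrite big_ord0 [a + _]addr0 subrr.
rewrite big_ord_recr /= IH intr_Zp_eq //.
have -> : a + n.+1%:Z - (i : nat)%:Z = a + n%:Z - (i : nat)%:Z + 1.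
  by rewrite intS; ring.
by rewrite divzS; [ring|lia].
Qed.

Lemma comp_count_beta_seq e (a : int) (p : Defs.partition) (i : 'Z_e) (N : nat) :
  (1 < e)%N -> (size p <= N)%N ->
  (comp_count a p i)%:Z
  = \sum_(x <- beta_seq N p) ((x%:Z + a - N%:Z - (i : nat)%:Z) %/ e%:Z)%Z
    - \sum_(b < N) ((a - b.+1%:Z - (i : nat)%:Z) %/ e%:Z)%Z.
Proof.
move=> he pN; rewrite (comp_countE _ _ pN) Posz_sum /beta_seq big_map.
rewrite -[N in iota 0 N]subn0 -/(index_iota 0 N) big_mkord -sumrB.
apply: eq_bigr => b _; rewrite row_countE //; congr ((_ %/ _)%Z - _).
by have := ltn_ord b; lia.
Qed.

Lemma sum_beads2 (b : nat) (c : int) :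
  (\sum_(y < b) (y%:Z - c)) *+ 2 = b%:Z * (b%:Z - 1 - c *+ 2).
Proof.
elim: b => [|b IH]; first by rewrite big_ord0 mul0rn mul0r.
by rewrite big_ord_recr /= mulrnDl IH intS; ring.
Qed.

Lemma divz_bead e (he : (1 < e)%N) (z : int) (l i : 'Z_e) :
  ((z * e%:Z + (l : nat)%:Z - (i : nat)%:Z) %/ e%:Z)%Z = z - (l < i)%N%:Z.
Proof.
have le := ord_Zp_lt l he; have ie := ord_Zp_lt i he.
have [li|il] := ltnP l i.
  have -> : z * e%:Z + (l : nat)%:Z - (i : nat)%:Z
      = (z - 1) * e%:Z + (e%:Z + (l : nat)%:Z - (i : nat)%:Z) by ring.
  rewrite divzMDl; last by lia.
  by rewrite divz_small ?addr0 //; lia.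
rewrite -addrA divzMDl; last by lia.
by rewrite divz_small ?addr0 ?subr0 //; lia.
Qed.

(** [G] is quantified before [p], so it cancels when two cores with the same charge are compared. *)
Lemma core_comp_count e (a : int) (K N : nat) (i : 'Z_e) : (1 < e)%N ->
  N%:Z = a + K%:Z * e%:Z ->
  exists G : int, forall p : Defs.partition, is_core e p -> (size p <= N)%N ->
    (comp_count a p i)%:Z *+ 2
    = \sum_(l : 'Z_e) level a p l ^+ 2
      - (\sum_(l : 'Z_e | (l < i)%N) level a p l) *+ 2 + G.
Proof.
move=> he NE.
exists (a - e%:Z - e%:Z * (K%:Z * (K%:Z + 1))
        - (\sum_(l : 'Z_e | (l < i)%N) (K%:Z + 1)) *+ 2
        - (\sum_(b < N) ((a - b.+1%:Z - (i : nat)%:Z) %/ e%:Z)%Z) *+ 2).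
move=> p cp pN; rewrite (comp_count_beta_seq _ _ he pN) mulrnBl addrA.
congr (_ - _); rewrite (perm_big _ (core_beta_seq he cp NE pN)) sum_runner_seq -sumrMnl.
(* With L the level and t the truth value of [l < i], the doubled contribution of runner [l] is (L +
   K + 1)(L - K - 2 t). *)
transitivity (\sum_(l : 'Z_e) (level a p l ^+ 2 + (level a p l - K%:Z * (K%:Z + 1))
   - ((l < i)%N%:Z * level a p l *+ 2 + (l < i)%N%:Z * (K%:Z + 1) *+ 2))).
  apply: eq_bigr => l _; have lK := level_ge l he cp NE pN.
  have bE : `|(level a p l + K%:Z + 1)%R|%N%:Z = level a p l + K%:Z + 1 by lia.
  rewrite (eq_bigr (fun y : 'I_ _ => (y : nat)%:Z - (K%:Z + (l < i)%N%:Z))).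
    rewrite sum_beads2 bE; case: (l < i)%N; ring.
  move=> y _; have -> : ((y * e + l)%N%:Z + a - N%:Z - (i : nat)%:Z)
      = (y%:Z - K%:Z) * e%:Z + (l : nat)%:Z - (i : nat)%:Z.
    by rewrite NE PoszD PoszM; ring.
  by rewrite divz_bead //; ring.
have sumif (F : 'Z_e -> int) :
    \sum_(l : 'Z_e) (l < i)%N%:Z * F l = \sum_(l : 'Z_e | (l < i)%N) F l.
  rewrite [RHS]big_mkcond; apply: eq_bigr => l _.
  by case: (l < i)%N; rewrite ?mul1r ?mul0r.
rewrite sumrB !big_split /= (sumif (level a p)) (sumif (fun=> K%:Z + 1)).
rewrite big_split /= sum_level // sumrN (sum_Zp_const _ he).
by ring.
Qed.

Lemma core_comp_countB e (a : int) (p p' : Defs.partition) (i : 'Z_e) : (1 < e)%N ->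
  is_core e p -> is_core e p' ->
  ((comp_count a p i)%:Z - (comp_count a p' i)%:Z) *+ 2
  = \sum_(l : 'Z_e) level a p l ^+ 2 - \sum_(l : 'Z_e) level a p' l ^+ 2
    - (\sum_(l : 'Z_e | (l < i)%N) level a p l
       - \sum_(l : 'Z_e | (l < i)%N) level a p' l) *+ 2.
Proof.
(* Both sizes enter [K] so that [a + K e] is a natural number bounding the two of them. *)
move=> he cp cp'; pose K := (size p + size p' + `|a|)%N.
have [N NE] : exists N : nat, N%:Z = a + K%:Z * e%:Z.
  by exists `|(a + K%:Z * e%:Z)%R|%N; nia.
have [G GE] := core_comp_count i he NE.
by rewrite mulrnBl !GE //; [ring|nia..].
Qed.

(** * Partitions and cores from prescribed beads *)

(* [s] lists beta-numbers in decreasing order; the rows may end with zeros. *)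
Fixpoint beta_rows (s : seq nat) : seq nat :=
  if s is x :: s' then (x - size s')%N :: beta_rows s' else [::].

Lemma size_beta_rows s : size (beta_rows s) = size s.
Proof. by elim: s => //= x s ->. Qed.

Lemma head_gtn_sorted x s : sorted gtn (x :: s) -> (size s <= x)%N.
Proof.
elim: s x => //= y s IH x /andP[yx /IH]; lia.
Qed.

Lemma beta_rows_sorted s : sorted gtn s -> sorted geq (beta_rows s).
Proof.
elim: s => //= x [|y s] //= IH /andP[yx sy]; rewrite IH // andbT.
by have := head_gtn_sorted sy; lia.
Qed.

Lemma nth_beta_rows s b : sorted gtn s -> (b < size s)%N ->
  (nth 0%N (beta_rows s) b + (size s - b.+1) = nth 0%N s b)%N.
Proof.
elim: s b => //= x s IH [|b] ss bs /=.
  by rewrite subSS subn0 subnK // head_gtn_sorted.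
by rewrite subSS IH // (path_sorted ss).
Qed.

(** In a weakly decreasing sequence the zeros come last, so removing them only truncates, and the
    default value of [nth] is 0. *)
Lemma nth_filter_gt0 s b : sorted geq s ->
  nth 0%N [seq x <- s | (0 < x)%N] b = nth 0%N s b.
Proof.
elim: s b => // -[|x] s IH b ss; last by case: b => //= b; rewrite IH // (path_sorted ss).
have s0 : all (fun y => y == 0%N) s.
  have := order_path_min (leT := geq) (fun x y z h1 h2 => leq_trans h2 h1) ss.
  by apply: sub_all => y; rewrite /= leqn0.
have -> : [seq y <- 0%N :: s | (0 < y)%N] = [::].
  by rewrite /= -(filter_pred0 s); apply: eq_in_filter => y /(allP s0)/eqP->.
rewrite nth_nil; case: b => //= b; case: (ltnP b (size s)) => bs; last by rewrite nth_default.
by rewrite (eqP (allP s0 _ (mem_nth _ bs))).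
Qed.

Lemma beta_seq_surj (s : seq nat) : sorted gtn s ->
  exists2 p : Defs.partition, (size p <= size s)%N & beta_seq (size s) p = s.
Proof.
move=> ss; have rs := beta_rows_sorted ss.
have pP : is_part [seq x <- beta_rows s | (0 < x)%N].
  rewrite /is_part sorted_filter //=; last by move=> x y z h1 h2; exact: leq_trans h2 h1.
  by rewrite mem_filter ltnn.
exists (Partition pP); first by rewrite /= -(size_beta_rows s) size_filter count_size.
apply: (@eq_from_nth _ 0%N); first by rewrite size_map size_iota.
move=> b; rewrite size_map size_iota => bs.
by rewrite (nth_map 0%N) ?size_iota // nth_iota // /part /= nth_filter_gt0 ?nth_beta_rows.
Qed.

(** Put [L l + K + 1] beads on runner [l] from level 0 on and read off the partition; the sum
    condition makes their number [a + K e], as charge [a] requires. *)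
Lemma core_of_levels e (a : int) (L : 'Z_e -> int) : (1 < e)%N ->
  \sum_l L l = a - e%:Z ->
  exists p : Defs.partition, is_core e p /\ forall l, level a p l = L l.
Proof.
move=> he sL; pose K := (\sum_l `|L l|)%N.
have LK l : - K%:Z <= L l by rewrite /K (bigD1 l) //=; lia.
pose b (l : 'Z_e) := `|(L l + K%:Z + 1)%R|%N.
have bE l : (b l)%:Z = L l + (K%:Z + 1) by have := LK l; rewrite /b; lia.
pose s := sort geq (runner_seq b).
have ss : sorted gtn s.
  rewrite gtn_sorted_uniq_geq sort_uniq runner_seq_uniq //=.
  by apply: sort_sorted => x y; exact: leq_total.
have [p pN ps] := beta_seq_surj ss; set N := size s in pN ps.
have NE : N%:Z = a + K%:Z * e%:Z.
  rewrite /N size_sort size_runner_seq Posz_sum (eq_bigr _ (fun l _ => bE l)).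
  by rewrite big_split /= sL (sum_Zp_const _ he); ring.
have beadE (l : 'Z_e) (y : int) : bead a p (y * e%:Z + (l : nat)%:Z) <-> y <= L l.
  have le := ord_Zp_lt l he.
  have [yK|Ky] := ltrP y (- K%:Z).
    split=> _; first by have := LK l; lia.
    by apply: bead_low pN _; rewrite NE; nia.
  have -> : y = `|(y + K%:Z)%R|%N%:Z - K%:Z by lia.
  set z := `|_|%N.
  have -> : (z%:Z - K%:Z) * e%:Z + (l : nat)%:Z = (z * e + l)%N%:Z + a - N%:Z.
    by rewrite NE PoszD PoszM; ring.
  rewrite -(mem_beta_seq a _ pN) ps mem_sort mem_runner_seq //.
  by have := bE l; split; lia.
exists p; split=> [|l]; last first.
  by apply: level_unique => [//||x]; rewrite beadE.
apply/(is_core_bead e a) => x.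
have [l xl] := Zp_edivn he `|(x %% e%:Z)%Z|%N.
have xE : x = (x %/ e%:Z)%Z * e%:Z + (l : nat)%:Z.
  have x0 : 0 <= (x %% e%:Z)%Z by apply: modz_ge0; lia.
  have xe : (x %% e%:Z)%Z < e%:Z by apply: ltz_pmod; lia.
  rewrite {1}(divz_eq x e%:Z); congr (_ + _).
  by move: xl; rewrite divn_small; lia.
rewrite xE beadE => xL.
have -> : (x %/ e%:Z)%Z * e%:Z + (l : nat)%:Z - e%:Z
    = ((x %/ e%:Z)%Z - 1) * e%:Z + (l : nat)%:Z by ring.
by rewrite beadE; lia.
Qed.

(** * Multicores *)

(* The g rim e-hooks are added to the end of the first row. *)
Lemma add_hooks_partition e (p : Defs.partition) (g : nat) : (1 < e)%N -> (0 < g)%N ->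
  exists p' : Defs.partition, ~ is_core e p' /\
    forall a (i : 'Z_e), comp_count a p' i = (comp_count a p i + g)%N.
Proof.
move=> he g0; set x := (part p 1 + e * g)%N.
have eg : (0 < e * g)%N by rewrite muln_gt0 (ltnW he).
have pP : is_part (x :: behead p).
  have /andP[sp p0] := partsP p; rewrite /is_part inE negb_or /x /part.
  move: sp p0; case: (parts p) => [|y [|z s]] /=; rewrite ?inE ?negb_or; lia.
pose p' := Partition pP.
have part1 : part p' 1 = x by [].
have partS b : part p' b.+2 = part p b.+2 by rewrite /part /= nth_behead.
exists p'; split=> [/is_core_bead-/(_ 0 (beta 0 p' 1)) | a i].
  (* The position [beta 0 p' 1 - e] lies strictly between the second bead and the first, so it is
     empty. *)
  case=> [|[|[|m]]] //; first by exists 1%N.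
    by move=> _; rewrite /beta; lia.
  move=> _; rewrite /beta part1 partS /x.
  have := part_noninc p (isT : 1 <= m.+2)%N; nia.
have sp' : (size p' <= (size p).+1)%N by rewrite /= size_behead; lia.
rewrite (comp_countE _ _ sp') (comp_countE _ _ (leqnSn _)) !big_ord_recl /=.
rewrite part1 addnAC; congr (_ + _)%N; last by apply: eq_bigr => b _; rewrite partS.
apply/eqP; rewrite -eqz_nat PoszD !row_countE // /x PoszD PoszM.
have -> : a - 1 + ((part p 1)%:Z + e%:Z * g%:Z) - (i : nat)%:Z
    = g%:Z * e%:Z + (a - 1 + (part p 1)%:Z - (i : nat)%:Z) by ring.
by rewrite divzMDl; [apply/eqP; ring|lia].
Qed.

Lemma add_hooks e r (la : multipartition r) (g : nat) :
  (0 < r)%N -> (1 < e)%N -> (0 < g)%N ->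
  exists mu : multipartition r, ~ multicore e mu /\
    forall ka (i : 'Z_e), res_count ka mu i = (res_count ka la i + g)%N.
Proof.
move=> r0 he g0; have [p [ncp pE]] := add_hooks_partition (la (Ordinal r0)) he g0.
exists [ffun j => if j == Ordinal r0 then p else la j]; split=> [/(_ (Ordinal r0))|ka i].
  by rewrite ffunE eqxx.
rewrite !res_countE (bigD1 (Ordinal r0)) //= [in RHS](bigD1 (Ordinal r0)) //=.
rewrite ffunE eqxx pE addnAC.
by congr (_ + _ + _)%N; apply: eq_bigr => j /negPf jN; rewrite ffunE jN.
Qed.

Definition levels e r (ka : 'I_r -> int) (la : multipartition r) :
  'M[int]_((Zp_trunc e).+2, r) := \matrix_(i, j) level (ka j) (la j) i.

Lemma multicore_res_countB e r (ka : 'I_r -> int) (la mu : multipartition r) (i : 'Z_e) :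
  (1 < e)%N -> multicore e la -> multicore e mu ->
  ((res_count ka la i)%:Z - (res_count ka mu i)%:Z) *+ 2
  = energy (levels e ka) la - energy (levels e ka) mu
    - (\sum_(l : 'Z_e | (l < i)%N) \sum_j (levels e ka la - levels e ka mu) l j) *+ 2.
Proof.
move=> he cla cmu; rewrite !res_countE !Posz_sum -sumrB -sumrMnl.
under eq_bigr do rewrite core_comp_countB //.
rewrite !sumrB; congr (_ - _ - _).
- rewrite exchange_big; apply: eq_bigr => l _; apply: eq_bigr => j _.
  by rewrite !mxE expr2.
- rewrite exchange_big; apply: eq_bigr => l _; apply: eq_bigr => j _.
  by rewrite !mxE expr2.
rewrite sumrMnl exchange_big sumrB; congr (_ *+ 2); rewrite -sumrB.
by apply: eq_bigr => j _; rewrite -sumrB; apply: eq_bigr => l _; rewrite !mxE.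
Qed.

(** The difference of counts at [i] depends on [i] only through the sum of the rows before [i]; it
    is constant exactly when these partial sums, hence all row sums, vanish. *)
Lemma multicore_shift_balanced e r (ka : 'I_r -> int) (la mu : multipartition r) :
  (1 < e)%N -> multicore e la -> multicore e mu ->
  (exists h : int, forall i : 'Z_e,
      (res_count ka la i)%:Z = (res_count ka mu i)%:Z + h) <->
  balanced (levels e ka la - levels e ka mu).
Proof.
move=> he cla cmu; have cE i := multicore_res_countB ka i he cla cmu.
pose D := levels e ka la - levels e ka mu; rewrite -/D in cE *.
have colD j : \sum_i D i j = 0.
  by under eq_bigr do rewrite !mxE; rewrite sumrB !sum_level // subrr.
split=> [[h hE] | [rowD _]]; last first.
  exists ((res_count ka la (0 : 'Z_e))%:Z - (res_count ka mu (0 : 'Z_e))%:Z) => i.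
  have := cE i; have := cE 0; rewrite !big1 => [|l _|l _]; try exact: rowD.
  by lia.
split=> // l.
pose R l := \sum_j D l j.
(* At [n = e] all rows are summed and the column sums give zero; for smaller [n], the residues [n]
   and 0 are compared. *)
have P0 n : (n <= e)%N -> \sum_(l : 'Z_e | (l < n)%N) R l = 0.
  rewrite leq_eqVlt => /predU1P[->|ne].
    under eq_bigl => k do rewrite (ord_Zp_lt k he).
    by rewrite exchange_big big1.
  have ne' : (n < (Zp_trunc e).+2)%N by rewrite Zp_cast.
  have := cE (Ordinal ne'); have := cE 0; rewrite !hE /= big_pred0_eq /R.
  by set S := \sum_(_ | _) _; lia.
have := P0 _ (ord_Zp_lt l he); rewrite (bigD1 l) //=.
rewrite (eq_bigl (fun k : 'Z_e => (k < l)%N)) => [|k]; last first.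
  by rewrite ltnS andbC -ltn_neqAle.
by rewrite P0 ?addr0 // ltnW // ord_Zp_lt.
Qed.

Lemma multicore_hub_balanced e r (ka : 'I_r -> int) (la mu : multipartition r) :
  (1 < e)%N -> multicore e la -> multicore e mu ->
  (forall i : 'Z_e, hub ka la i = hub ka mu i) <->
  balanced (levels e ka la - levels e ka mu).
Proof.
by move=> he cla cmu; rewrite -multicore_shift_balanced // hub_eq_shift.
Qed.

(** With zero row sums only the energies remain in [multicore_res_countB]. *)
Lemma balanced_res_count e r (ka : 'I_r -> int) (la mu : multipartition r) :
  (1 < e)%N -> multicore e la -> multicore e mu ->
  balanced (levels e ka la - levels e ka mu) ->
  exists h : int,
    energy (levels e ka) la - energy (levels e ka) mu = h *+ 2 /\
    forall i : 'Z_e, (res_count ka la i)%:Z = (res_count ka mu i)%:Z + h.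
Proof.
move=> he cla cmu b; have [h hE] := (multicore_shift_balanced ka he cla cmu).2 b.
exists h; split=> //; have := multicore_res_countB ka 0 he cla cmu.
rewrite hE big1 => [|l _]; first by lia.
by have [rowD _] := b.
Qed.

(** A swap matrix has zero column sums, so each new column still meets the sum condition of
    [core_of_levels]. *)
Lemma swap_multicore e r (ka : 'I_r -> int) (la : multipartition r)
    (i l : 'Z_e) (j k : 'I_r) : (1 < e)%N -> multicore e la ->
  exists2 mu, multicore e mu & levels e ka mu = levels e ka la + swapmx i l j k.
Proof.
move=> he cla; pose L := levels e ka la + swapmx i l j k.
have /fin_all_exists[p pP] : forall y : 'I_r, exists p : Defs.partition,
    is_core e p /\ forall h : 'Z_e, level (ka y) p h = L h y.
  move=> y; apply: core_of_levels => //.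
  under eq_bigr do rewrite mxE [levels _ _ _ _ _]mxE; rewrite big_split /= sum_level //.
  by have [_ ->] := balanced_swapmx i l j k; rewrite addr0.
exists [ffun y => p y] => [y|]; first by rewrite ffunE; case: (pP y).
by apply/matrixP => h y; rewrite mxE ffunE (pP y).2.
Qed.

(** * Multicharges, weights and core blocks *)

(** The two charges differ by a multiple of [e], which moves every bead of the component by the same
    number of levels. *)
Lemma multicharge_level e r (ka a : 'I_r -> int) (y : 'I_r) :
  (1 < e)%N -> multicharge e ka a ->
  exists c : int, forall (p : Defs.partition) (h : 'Z_e), level (a y) p h = level (ka y) p h + c.
Proof.
move=> he /(_ y) akE.
exists ((a y %/ e%:Z)%Z - (ka y %/ e%:Z)%Z) => p h; rewrite -level_shift //.
by congr level; rewrite {1}(divz_eq (a y) e%:Z) akE {2}(divz_eq (ka y) e%:Z); ring.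
Qed.

(** Joins the two phases while keeping the index [v] at which the second begins. *)
Lemma chain_concat (T : Type) (R1 R2 : T -> T -> Prop) (x y z : T) :
  chain R1 x y -> chain R2 y z ->
  exists (v s : nat) (f : nat -> T),
    [/\ (v <= s)%N, [/\ f 0%N = x, f v = y & f s = z],
        forall t, (t < v)%N -> R1 (f t) (f t.+1)
      & forall t, (v <= t)%N -> (t < s)%N -> R2 (f t) (f t.+1)].
Proof.
move=> [v [f [f0 fv fR]]] [s [g [g0 gs gR]]].
pose k t := if (t < v)%N then f t else g (t - v)%N.
have kf t : (t <= v)%N -> k t = f t.
  by rewrite /k leq_eqVlt => /predU1P[->|->//]; rewrite ltnn subnn g0.
have kg t : (v <= t)%N -> k t = g (t - v)%N by rewrite /k ltnNge => ->.
exists v, (v + s)%N, k; split; first exact: leq_addr.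
- by split; [rewrite kf|rewrite kf|rewrite kg ?leq_addr // addKn].
- by move=> t tv; rewrite !kf ?(ltnW tv) //; exact: fR.
- by move=> t vt ts; rewrite !kg ?(leqW vt) // subSn //; apply: gR; rewrite ltn_subLR.
Qed.

Lemma swapped_is_swap e r (ka a : 'I_r -> int) (la mu : multipartition r)
    (i l : 'Z_e) (j k : 'I_r) : (1 < e)%N -> multicharge e ka a -> multicore e mu ->
  levels e ka mu = levels e ka la + swapmx i l j k -> is_swap a la i l j k mu.
Proof.
move=> he mca cmu E; split=> // h y.
have [c cE] := multicharge_level y he mca.
by move/matrixP: E => /(_ h y); rewrite !cE !mxE => ->; ring.
Qed.

Lemma gamma2E e r (ka a : 'I_r -> int) (la : multipartition r) (i l : 'Z_e) (j k : 'I_r) :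
  (1 < e)%N -> multicharge e ka a ->
  gamma2 a la i l j k = - frobmx (swapmx i l j k) (levels e ka la).
Proof.
move=> he mca; rewrite frob_swapmx !mxE /gamma2 /gamma.
have [c cE] := multicharge_level j he mca.
have [d dE] := multicharge_level k he mca.
by rewrite !cE !dE; ring.
Qed.

Lemma core_block_min e r (ka : 'I_r -> int) (C : multipartition r -> Prop)
    (la mu : multipartition r) (h : int) : (0 < r)%N -> (1 < e)%N ->
  is_core_block e ka C -> C mu ->
  (forall i : 'Z_e, (res_count ka la i)%:Z = (res_count ka mu i)%:Z + h) ->
  h <= 0 -> C la.
Proof.
move=> r0 he [[nu CE] Cmc] Cmu cE h0.
have CP xi : (forall i : 'Z_e, res_count ka xi i = res_count ka mu i) -> C xi.
  move=> xiE; apply/CE; apply: perm_trans ((CE mu).1 Cmu) _.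
  by apply/allP => i _ /=; apply/eqP; rewrite -[RHS]/(res_count ka xi i) xiE.
have [hE|hN] := eqVneq h 0.
  by apply: CP => i; have := cE i; rewrite hE addr0 => -[].
(* Here [h < 0]: adding [- h] hooks brings the counts of [la] to those of [mu], which would put a
   multipartition that is not a multicore in [C]. *)
have [|xi [ncxi xiE]] := @add_hooks e r la `|h|%N r0 he; first by rewrite absz_gt0.
case: ncxi; apply: Cmc; apply: CP => i; rewrite xiE; have := cE i; lia.
Qed.

(** The weights differ by [r h] and the energies by [2 h], with the same [h]. *)
Lemma weight_energy_lt e r (ka : 'I_r -> int) (la mu : multipartition r) :
  (0 < r)%N -> (1 < e)%N -> multicore e la -> multicore e mu ->
  balanced (levels e ka la - levels e ka mu) ->
  (weight e ka la < weight e ka mu)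
  = (energy (levels e ka) la < energy (levels e ka) mu).
Proof.
move=> r0 he cla cmu b; have [h [hF hE]] := balanced_res_count he cla cmu b.
rewrite (weight_shift hE) gtrDl ltrz0; apply/idP/idP; nia.
Qed.

Lemma weight_energy_le e r (ka : 'I_r -> int) (la mu : multipartition r) :
  (0 < r)%N -> (1 < e)%N -> multicore e la -> multicore e mu ->
  balanced (levels e ka la - levels e ka mu) ->
  (weight e ka la <= weight e ka mu)
  = (energy (levels e ka) la <= energy (levels e ka) mu).
Proof.
move=> r0 he cla cmu b; rewrite !leNgt weight_energy_lt //.
by rewrite -opprB -sub0r; apply: balancedB => //; split=> ?; rewrite big1 // => ? _; rewrite mxE.
Qed.

Theorem proposition4p3 (r : nat) (hr : (0 < r)%N) (F : fieldType)
    (e : nat) (he : (1 < e)%N) (q : F) (hq : e.-primitive_root q)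
    (ka : 'I_r -> int) (n : nat) (m : multipartition r)
    (hmn : msize m = n) (hm : multicore e m)
    (C : multipartition r -> Prop) (hC : is_core_block_of e ka m C) :
  exists (mu : multipartition r) (s : nat) (ms : nat -> multipartition r),
    [/\ multicore e mu /\ C mu,
        [/\ ms 0%N = m, ms s = mu & forall t, (t <= s)%N -> multicore e (ms t)],
        (forall t, (t <= s)%N -> is_core_block_of e ka (ms t) C),
        (forall t, (t < s)%N -> exists (i l : 'Z_e) (j k : 'I_r),
           forall a : 'I_r -> int, multicharge e ka a ->
             is_swap a (ms t) i l j k (ms t.+1))
      & exists v : nat,
          [/\ (v <= s)%N,
              (forall t, (t < v)%N -> weight e ka (ms t.+1) < weight e ka (ms t)),
              (forall t, (v <= t)%N -> (t < s)%N ->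
                 weight e ka (ms t.+1) <= weight e ka (ms t))
            & forall a : 'I_r -> int, multicharge e ka a ->
                forall (i l : 'Z_e) (j k : 'I_r),
                  `|gamma2 a (ms v) i l j k| <= 2]].
Proof.
have [[[nu CE] Cmc] Chub] := hC.
have Cnu : C nu by apply/CE; exact: perm_refl.
have cnu := Cmc _ Cnu.
have swapE x i l j k := @swap_multicore e r ka x i l j k he.
pose sw := swapped (@multicore e r) (levels e ka).
have [y my yg] := strict_chain swapE hm.
have [cy by_] := chain_swapped (fun u v h => proj1 h) hm my.
(* [nu] has the hub of [m], and [y] was reached by swaps, so the level matrix of [nu] can be the
   target of the second phase. *)
have bnu : balanced (levels e ka nu - levels e ka y).
  have -> : levels e ka nu - levels e ka y
      = (levels e ka nu - levels e ka m) - (levels e ka y - levels e ka m).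
    by rewrite opprB addrA subrK.
  apply: balancedB by_; apply/(multicore_hub_balanced ka he cnu hm).
  exact: Chub.
have [z yz zF] := weak_chain_le swapE cy bnu.
have [v [s [f [vs [f0 fv fs] f1 f2]]]] := chain_concat my yz.
have fsw t : (t < s)%N -> sw (f t) (f t.+1).
  by have [tv _|vt ts] := ltnP t v; [case: (f1 t tv)|case: (f2 t vt ts)].
have finv t : (t <= s)%N ->
    multicore e (f t) /\ balanced (levels e ka (f t) - levels e ka m).
  move=> ts; apply: (@chain_swapped _ _ _ _ _ sw) => //.
  by exists t, f; split=> // u ut; apply: fsw; exact: leq_trans ts.
have fhub t (i : 'Z_e) : (t <= s)%N -> hub ka (f t) i = hub ka m i.
  by move=> /finv[ct bt]; exact: (multicore_hub_balanced ka he ct hm).2.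
have fbal t : (t < s)%N -> balanced (levels e ka (f t.+1) - levels e ka (f t)).
  move=> ts; have [c1 _] := finv _ ts; have [c0 _] := finv _ (ltnW ts).
  by apply/(multicore_hub_balanced ka he c1 c0) => i; rewrite !fhub // ltnW.
have [cz bz] := finv s (leqnn s); rewrite fs in cz bz.
have Cz : C z.
  have bzn : balanced (levels e ka z - levels e ka nu).
    apply/(multicore_hub_balanced ka he cz cnu) => i.
    by rewrite -fs fhub // (Chub _ Cnu).
  have [h [hF hE]] := balanced_res_count he cz cnu bzn.
  (* The energy of [z] is at most that of [nu], so [h <= 0]. *)
  apply: (core_block_min hr he (proj1 hC) Cnu hE).
  by move: zF hF; rewrite -/(energy (levels e ka) nu); lia.
exists z, s, f; split=> //.
- by split=> // t /finv[].
- by move=> t ts; split; [case: hC|move=> mu Cmu i; rewrite fhub // Chub].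
- move=> t ts; have [c1 [i [l [j [k E]]]]] := fsw t ts.
  by exists i, l, j, k => a mca; exact: (swapped_is_swap he mca c1 E).
exists v; split=> //.
- move=> t tv; have ts := leq_trans tv vs.
  have [c1 _] := finv _ ts; have [c0 _] := finv _ (ltnW ts).
  by rewrite (weight_energy_lt hr he c1 c0 (fbal t ts)); case: (f1 t tv).
- move=> t vt ts; have [c1 _] := finv _ ts; have [c0 _] := finv _ (ltnW ts).
  by rewrite (weight_energy_le hr he c1 c0 (fbal t ts)); case: (f2 t vt ts).
(* The bound at the end of the strict phase, for a swap and for its reverse, bounds [gamma2] on both
   sides. *)
move=> a mca i l j k; rewrite fv (gamma2E y i l j k he mca) normrN.
have := yg i l j k; have := yg l i j k; rewrite !frob_swapmx; lia.
Qed.
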